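(* The inclusions $cs^{\lambda}\subset c_0^{\lambda}$ and $bs^{\lambda}\subset \ell_{\infty}^{\lambda}$ hold and both are strict.
   Context: $\mathbb{N}=\{0,1,2,\dots\}$ and $w=\mathbb{C}^{\mathbb{N}}$ is the space of all complex sequences. $\lambda=(\lambda_k)_{k\in\mathbb{N}}$ is a fixed strictly increasing sequence of positive reals tending to infinity, with the convention $\lambda_{-1}=0$. For $x=(x_k)\in w$ put $\Lambda(x)=(\Lambda_n(x))_{n\in\mathbb{N}}$, $\Lambda_n(x)=\frac{1}{\lambda_n}\sum_{k=0}^{n}(\lambda_k-\lambda_{k-1})x_k$. $cs$ and $bs$ are the spaces of sequences $x\in w$ whose sequence of partial sums $\left(\sum_{n=0}^m x_n\right)_m$ is, respectively, convergent, bounded; $c_0$ and $\ell_\infty$ are the spaces of null and of bounded sequences. Define $cs^{\lambda}=\{x\in w:\Lambda(x)\in cs\}$, $bs^{\lambda}=\{x\in w:\Lambda(x)\in bs\}$, $c_0^{\lambda}=\{x\in w:\Lambda(x)\in c_0\}$, $\ell_\infty^{\lambda}=\{x\in w:\Lambda(x)\in \ell_\infty\}$. *)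

(* Defs.v *)
From HB Require Import structures.
From mathcomp Require Import all_boot all_order all_algebra.
From mathcomp Require Import complex.
From mathcomp Require Import all_classical all_reals all_analysis.

Set Implicit Arguments.
Unset Strict Implicit.
Unset Printing Implicit Defensive.

Import Order.TTheory GRing.Theory Num.Theory.
Import numFieldNormedType.Exports.

Local Open Scope classical_set_scope.
Local Open Scope ring_scope.
Local Open Scope complex_scope.

(* The classical sequence spaces are set up over any numFieldType K, because a
   numFieldType carries the topology of its norm whereas complex.v declares no
   topology on R[i] itself; they are used below at K := R[i], whose norm is the
   complex modulus. *)
Definition partial_sums (K : numFieldType) (x : nat -> K) (m : nat) : K :=
  \sum_(n < m.+1) x n.

Definition c0 (K : numFieldType) : set (nat -> K) :=
  [set x | x @ \oo --> (0 : K)].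

Definition ell_infty (K : numFieldType) : set (nat -> K) :=
  [set x | bounded_fun x].

Definition cs (K : numFieldType) : set (nat -> K) :=
  [set x | cvgn (partial_sums x)].

Definition bs (K : numFieldType) : set (nat -> K) :=
  [set x | bounded_fun (partial_sums x)].

(* The value of l at k - 1, with the convention l_(-1) = 0. *)
Definition prev_term (R : realType) (l : nat -> R) (k : nat) : R :=
  if k is j.+1 then l j else 0.

Definition Lambda (R : realType) (l : nat -> R) (x : nat -> R[i]) (n : nat)
    : R[i] :=
  ((l n)^-1)%:C * \sum_(k < n.+1) (l k - prev_term l k)%:C * x k.

Definition cs_lambda (R : realType) (l : nat -> R) : set (nat -> R[i]) :=
  [set x | @cs R[i] (Lambda l x)].

Definition bs_lambda (R : realType) (l : nat -> R) : set (nat -> R[i]) :=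
  [set x | @bs R[i] (Lambda l x)].

Definition c0_lambda (R : realType) (l : nat -> R) : set (nat -> R[i]) :=
  [set x | @c0 R[i] (Lambda l x)].

Definition ell_infty_lambda (R : realType) (l : nat -> R)
    : set (nat -> R[i]) :=
  [set x | @ell_infty R[i] (Lambda l x)].

(* Main.v *)
(** Since [l] is positive and strictly increasing, [Lambda l] maps onto all
    sequences, so both claims reduce to the classical ones: the terms of a
    convergent (bounded) series tend to 0 (are bounded), the harmonic sequence
    separates [cs] from [c0], and the constant sequence 1 separates [bs] from
    [ell_infty]. *)
Require Import Defs.
From HB Require Import structures.
From mathcomp Require Import all_boot all_order all_algebra.
From mathcomp Require Import complex.
From mathcomp Require Import all_classical all_reals all_analysis.

Import Order.TTheory GRing.Theory Num.Theory.
Import numFieldNormedType.Exports.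

Local Open Scope classical_set_scope.
Local Open Scope ring_scope.

Lemma partial_sumsS (K : numFieldType) (x : nat -> K) (m : nat) :
  partial_sums x m.+1 = partial_sums x m + x m.+1.
Proof. by rewrite /partial_sums big_ord_recr. Qed.

Lemma cs_sub_c0 (K : numFieldType) : @cs K `<=` @c0 K.
Proof.
move=> x /cvg_ex[s xs].
have xsS : (fun m => partial_sums x m.+1) @ \oo --> s.
  by rewrite (cvg_shiftS (partial_sums x)).
have := cvgB xsS xs; rewrite subrr => x0.
rewrite /c0 /= -(cvg_shiftS x).
rewrite (_ : (fun m => x m.+1) =
             (fun m => partial_sums x m.+1) \- partial_sums x); first exact: x0.
by apply/funext => m /=; rewrite partial_sumsS addrC addKr.
Qed.

Lemma bs_sub_ell_infty (K : numFieldType) : @bs K `<=` @ell_infty K.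
Proof.
move=> x [M [Mreal xM]].
(* [xM] bounds the partial sums only by numbers strictly above [M], hence [M + 1]; a term is a
   difference of two partial sums, hence the doubling. *)
exists (M + 1 + (M + 1)); split; first by rewrite !realD // real1.
move=> N MN n _ /=; apply: le_trans (ltW MN).
have psM m : `|partial_sums x m| <= M + 1 by apply: xM; rewrite ?ltrDl.
case: n => [|n].
  have -> : x 0%N = partial_sums x 0 by rewrite /partial_sums big_ord1.
  apply: le_trans (psM 0%N) _; rewrite lerDl.
  exact: le_trans (psM 0%N).
rewrite (_ : x n.+1 = partial_sums x n.+1 - partial_sums x n); last first.
  by rewrite partial_sumsS addrC addKr.
by apply: le_trans (ler_normB _ _) _; exact: lerD.
Qed.

(** Oresme's argument: the block of indices [n + 1] to [2n + 1] has [n + 1] terms, each at least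
    [1 / (2n + 2)], so it sums to at least [1/2]. Convergence would make these blocks tend to
    [s - s = 0]. *)
Lemma harmonic_notin_cs (K : numFieldType) : ~ @cs K (fun n => n.+1%:R^-1).
Proof.
set h := fun n => _; move=> /cvg_ex[s hs].
have half_le n : 2^-1 <= partial_sums h (n + n.+1)%N - partial_sums h n.
  have -> : partial_sums h (n + n.+1)%N - partial_sums h n
      = \sum_(i < n.+1) h (n.+1 + i)%N.
    rewrite /partial_sums -addSn big_split_ord /= [LHS]addrC addKr.
    by apply: eq_bigr.
  have -> : 2^-1 = \sum_(i < n.+1) (n.+1 + n.+1)%:R^-1 :> K.
    rewrite sumr_const card_ord.
    by rewrite addnn -mul2n natrM invfM -[RHS]mulr_natr -mulrA mulVf ?mulr1
      ?pnatr_eq0.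
  apply: ler_sum => i _; rewrite /h lef_pV2 ?posrE ?ltr0n //.
  by rewrite ler_nat -addnS leq_add2l.
have h2s : (fun n => partial_sums h (n + n.+1)%N) @ \oo --> s.
  apply: (cvg_comp (fun n => (n + n.+1)%N) (partial_sums h) _ hs).
  move=> A [N _ NA]; exists N => // n /= Nn; apply: NA => /=.
  exact: leq_trans Nn (leq_addr _ _).
have /cvgrPdist_lt d_lt :
    (fun n => partial_sums h (n + n.+1)%N - partial_sums h n) @ \oo --> s - s.
  exact: cvgB h2s hs.
have [|N _ /(_ N (leqnn N)) /=] := d_lt 2^-1; first by rewrite invr_gt0 ltr0n.
rewrite subrr sub0r normrN => lt_half.
have d0 : 0 <= partial_sums h (N + N.+1)%N - partial_sums h N.
  by apply: le_trans (half_le N); rewrite invr_ge0 ler0n.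
by move: lt_half; rewrite ger0_norm // => /lt_geF; rewrite half_le.
Qed.

Lemma harmonic_in_c0 (R : realType) : @c0 R[i] (fun n => n.+1%:R^-1).
Proof.
(* A positive element of [R[i]] is real, so the radius comes from some [e] in [R], where the
   Archimedean property is available. *)
apply/cvgrPdist_lt => _ /[dup] /gtr0_real/complex_realP[e ->].
rewrite ltcR => e0.
exists (Num.bound e^-1) => // n /= Nn.
rewrite sub0r normrN ger0_norm ?invr_ge0 ?ler0n //.
rewrite invf_plt ?posrE ?ltr0n ?ltcR // -fmorphV.
rewrite -(rmorph_nat (real_complex R)) ltcR.
have e1 : 0 <= e^-1 by rewrite invr_ge0 ltW.
by apply: lt_le_trans (archi_boundP e1) _; rewrite ler_nat leqW.
Qed.

Lemma cst1_in_ell_infty (K : numFieldType) : @ell_infty K (fun=> 1).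
Proof.
by exists 1; split=> [|M M1 n _ /=]; rewrite ?real1 // normr1 ltW.
Qed.

Lemma cst1_notin_bs (R : realType) : ~ @bs R[i] (fun=> 1).
Proof.
move=> [_ [/complex_realP[M ->] psM]].
have := psM (M%:C%C + 1); rewrite ltrDl ltr01 => /(_ isT).
(* At index [n] the partial sum is [n + 1], which for this [n] exceeds the supposed bound
   [M + 1]. *)
move=> /(_ (Num.bound `|M + 1|) I) /=.
rewrite /partial_sums sumr_const card_ord normr_nat.
rewrite -(rmorph_nat (real_complex R))
  -(rmorph1 (real_complex R)) -rmorphD lecR.
apply/negP; rewrite -ltNge.
apply: le_lt_trans (ler_norm _) _.
by apply: lt_le_trans (archi_boundP (normr_ge0 _)) _; rewrite ler_nat.
Qed.

(** The weighted sums must equal [l n * y n], so each [x k] is forced to be their increment divided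
    by the nonzero weight; the sum then telescopes. *)
Lemma Lambda_surj (R : realType) (l : nat -> R) (l_pos : forall k, 0 < l k)
    (l_incr : forall j k, (j < k)%N -> l j < l k) (y : nat -> R[i]) :
  exists x, Lambda l x = y.
Proof.
(* The index is shifted by one: [ly k.+1] is [l k * y k], and [ly 0 = 0] reflects the convention at
   index -1. *)
pose ly k := if k is j.+1 then (l j)%:C%C * y j else 0.
exists (fun k => (ly k.+1 - ly k) / (l k - prev_term l k)%:C%C).
apply/funext => n; rewrite /Lambda.
under eq_bigr => k _.
  rewrite mulrC divfK; last first.
    rewrite fmorph_eq0 subr_eq0 gt_eqF //.
    by case: (nat_of_ord k) => [|j] /=; [exact: l_pos | exact: l_incr].
  over.
rewrite -(big_mkord xpredT (fun k => ly k.+1 - ly k)) telescope_sumr //= subr0.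
by rewrite mulrA -rmorphM /= mulVf ?gt_eqF // rmorph1 mul1r.
Qed.

Theorem theorem3p4 (R : realType) (l : nat -> R)
  (l_pos : forall k, 0 < l k)
  (l_incr : forall j k, (j < k)%N -> l j < l k)
  (l_infty : l @ \oo --> +oo) :
  cs_lambda l `<` c0_lambda l /\ bs_lambda l `<` ell_infty_lambda l.
Proof.
split; split=> [|sub].
- by move=> x; exact: cs_sub_c0.
(* The reverse inclusion [sub], applied to a [Lambda l]-preimage of the harmonic sequence, would
   make the harmonic series converge. *)
- have [x xE] := Lambda_surj R l l_pos l_incr (fun n => n.+1%:R^-1).
  apply: (@harmonic_notin_cs R[i]); rewrite -xE; apply: (sub x).
  rewrite /c0_lambda /= xE; exact: harmonic_in_c0.
- by move=> x; exact: bs_sub_ell_infty.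
- have [x xE] := Lambda_surj R l l_pos l_incr (fun=> 1).
  apply: (@cst1_notin_bs R); rewrite -xE; apply: (sub x).
  rewrite /ell_infty_lambda /= xE; exact: cst1_in_ell_infty.
Qed.
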